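(* Let $X$ be a (real) Banach lattice that does not contain $\ell_\infty^n$ uniformly for every $n$; that is, there is no constant $\lambda \ge 1$ such that for every $n \in \mathbb{N}$ there are an $n$-dimensional subspace $E_n \subseteq X$ and a linear isomorphism $T_n : \ell_\infty^n \to E_n$ with $\|T_n\|\,\|T_n^{-1}\| \le \lambda$. Then $X$ is $\tau$-UKK-able, i.e. $X$ has an equivalent norm which is $\tau$-UKK.
   Context: The topology $\tau$ on a Banach lattice $X$ is the coarsest linear topology for which the maps $x \mapsto \|\,|x| \wedge |u|\,\|$ are continuous at $0$ for every $u \in X$. A basis of neighborhoods of a point $x \in X$ is formed by the sets $\{y \in X : \|\,|y-x| \wedge u\| \le \varepsilon\}$ with $u \in X$, $u \ge 0$, and $\varepsilon > 0$; so $x_n \to x$ in $\tau$ iff $\|\,|x_n - x| \wedge u\| \to 0$ for every $u \ge 0$ in $X$ (here $\|\cdot\|$ is the given lattice norm of $X$). A norm $\|\cdot\|_1$ on $X$, equivalent to the given one, is $\tau$-UKK (uniformly Kadec-Klee for $\tau$) if for every $\varepsilon > 0$ there exists $\delta > 0$ such that for every sequence $(x_n)$ with $\|x_n\|_1 \le 1$ for all $n$ and $\inf\{\|x_n - x_m\|_1 : n \ne m\} \ge \varepsilon$ which $\tau$-converges to some $x \in X$, one has $\|x\|_1 \le 1 - \delta$. *)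

(* Defs.v *)
(* MathComp-Analysis; the scalar field is R : realType. *)
From HB Require Import structures.
From mathcomp Require Import all_boot all_order all_algebra.
From mathcomp Require Import all_classical all_reals all_analysis.
Set Implicit Arguments.
Unset Strict Implicit.
Unset Printing Implicit Defensive.
Import Order.TTheory GRing.Theory Num.Theory numFieldNormedType.Exports.
Local Open Scope classical_set_scope.
Local Open Scope ring_scope.

(* The order is part of the mixin, rather than inherited from Order.Lattice,
   because the hierarchy has no join of the normed modules and the lattices; the
   Order.Lattice instance is recovered below. *)
HB.mixin Record isBanachLattice (R : realType) X
    of CompleteNormedModule R X := {
  ble : rel X ;
  bmeet : X -> X -> X ;
  bjoin : X -> X -> X ;
  ble_refl : reflexive ble ;
  ble_anti : antisymmetric ble ;
  ble_trans : transitive ble ;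
  ble_meet : forall x y z : X, ble x (bmeet y z) = ble x y && ble x z ;
  bjoin_le : forall x y z : X, ble (bjoin x y) z = ble x z && ble y z ;
  ble_add : forall x y z : X, ble x y -> ble (x + z) (y + z) ;
  bscale_ge0 : forall (a : R) (x : X), 0 <= a -> ble 0 x -> ble 0 (a *: x) ;
  ble_norm : forall x y : X,
    ble (bjoin x (- x)) (bjoin y (- y)) -> `|x| <= `|y|
}.

#[short(type="banachLatticeType")]
HB.structure Definition BanachLattice (R : realType) :=
  {X of CompleteNormedModule R X & isBanachLattice R X}.

#[non_forgetful_inheritance]
HB.instance Definition _ (R : realType) (X : banachLatticeType R) :=
  Order.Le_isPOrder.Build ring_display X
    (@ble_refl _ X) (@ble_anti _ X) (@ble_trans _ X).
#[non_forgetful_inheritance]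
HB.instance Definition _ (R : realType) (X : banachLatticeType R) :=
  Order.POrder_isMeetSemilattice.Build ring_display X (@ble_meet _ X).
#[non_forgetful_inheritance]
HB.instance Definition _ (R : realType) (X : banachLatticeType R) :=
  Order.POrder_isJoinSemilattice.Build ring_display X (@bjoin_le _ X).

Section BanachLatticeDefs.
Variables (R : realType) (X : banachLatticeType R).

(* `|x| is always the norm of x; its lattice absolute value is [modulus x]. *)
Definition modulus (x : X) : X := Order.join x (- x).

(* Filter of neighborhoods of x for the topology tau: it is generated by the
   sets of y such that || |y - x| /\ u || <= e, with u >= 0 and e > 0. *)
Definition tau_nbhs (x : X) : set_system X :=
  [set A | exists (u : X) (e : R),
    [/\ 0 <= u, 0 < e &
        [set y | `|Order.meet (modulus (y - x)) u| <= e] `<=` A]].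

Definition is_norm (N : X -> R) : Prop :=
  [/\ forall x y, N (x + y) <= N x + N y,
      forall (a : R) x, N (a *: x) = `|a| * N x &
      forall x, N x = 0 -> x = 0].

Definition equivalent_norm (N : X -> R) : Prop :=
  is_norm N /\
  exists a b : R, [/\ 0 < a, 0 < b &
    forall x, a * `|x| <= N x /\ N x <= b * `|x|].

Definition tau_UKK (N : X -> R) : Prop :=
  forall eps : R, 0 < eps -> exists2 delta : R, 0 < delta &
    forall (x_ : nat -> X) (x : X),
      (forall n, N (x_ n) <= 1) ->
      eps <= inf [set r | exists n m : nat, n <> m /\ r = N (x_ n - x_ m)] ->
      x_ @ \oo --> tau_nbhs x ->
      N x <= 1 - delta.

Definition subspace_of_dim (n : nat) (E : set X) : Prop :=
  exists b : 'I_n -> X,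
    (forall c : 'I_n -> R, \sum_i c i *: b i = 0 -> forall i, c i = 0) /\
    E = [set \sum_i c i *: b i | c in [set: 'I_n -> R]].

(* Operator norm of f on the unit ball of the subspace D, as an extended real
   so that an unbounded f gets norm +oo. *)
Definition opnorm (V W : normedModType R) (D : set V) (f : V -> W) : \bar R :=
  ereal_sup [set `|f x|%:E | x in [set x | D x /\ `|x| <= 1]].

(* The norm of 'rV[R]_n is the sup norm, so 'rV[R]_n is l_oo^n; S plays the
   role of T^-1 on E. *)
Definition linfty_copy (lam : R) (n : nat) : Prop :=
  exists (E : set X) (T : {linear 'rV[R]_n -> X}) (S : X -> 'rV[R]_n),
    [/\ subspace_of_dim n E,
        set_bij [set: 'rV[R]_n] E T,
        cancel T S &
        (opnorm [set: 'rV[R]_n] T * opnorm E S <= lam%:E)%E].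

Definition contains_linfty_uniformly : Prop :=
  exists2 lam : R, 1 <= lam & forall n : nat, linfty_copy lam n.

Definition tau_UKK_able : Prop :=
  exists N : X -> R, equivalent_norm N /\ tau_UKK N.

End BanachLatticeDefs.

Arguments contains_linfty_uniformly {R} X.
Arguments tau_UKK_able {R} X.

(* Main.v *)
(* Positive, pairwise disjoint vectors of norm at least 1 whose sum has norm at
   most 2 span a 2-isomorphic copy of l_oo^n.  Hence for some n any n such
   vectors have a sum of norm at least 2, any n^j of them a sum of norm at least
   2^j, and splitting a disjoint family by the dyadic size of its members gives
   a lower estimate sum |z|^q <= C |sum z|^q with q = n.

   Let N x be the supremum of (sum |z|^q)^(1/q) over the disjoint positive
   families with sum below the modulus of x.  This is an equivalent lattice norm
   (the triangle inequality follows from Riesz decomposition and Minkowski), and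
   N (a + b)^q >= N a^q + N b^q for disjoint a and b.  If x_n tends to x in tau,
   then y = x_n - x is almost disjoint from x, so N x^q + N y^q is at most 1 up
   to a small error, while the separation of the sequence forces N y >= eps / 2
   for arbitrarily large n. *)
From HB Require Import structures.
Require Import Defs.
From mathcomp Require Import all_boot all_order all_algebra.
From mathcomp Require Import all_classical all_reals all_analysis.
From mathcomp Require Import ring lra.
Set Implicit Arguments.
Unset Strict Implicit.
Unset Printing Implicit Defensive.
Import Order.TTheory GRing.Theory Num.Theory numFieldNormedType.Exports.
Local Open Scope ring_scope.
Local Notation meet := Order.meet.
Local Notation join := Order.join.

(** * Order arithmetic of a vector lattice, and the modulus *)

Section VectorLattice.
Variables (R : realType) (X : banachLatticeType R).
Implicit Types (x y z u v w : X) (a b : R).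

Lemma vle_add2r z x y : (x + z <= y + z) = (x <= y).
Proof.
apply/idP/idP => [h|]; last exact: ble_add.
by rewrite -[x](addrK z) -[y](addrK z); exact: ble_add.
Qed.

Lemma vle_add2l z x y : (z + x <= z + y) = (x <= y).
Proof. by rewrite ![z + _]addrC vle_add2r. Qed.

Lemma vleD x y u v : x <= y -> u <= v -> x + u <= y + v.
Proof. by move=> xy uv; rewrite (le_trans (y := y + u)) ?vle_add2r ?vle_add2l. Qed.

Lemma vsubr_ge0 x y : (0 <= y - x) = (x <= y).
Proof. by rewrite -(vle_add2r x 0) add0r subrK. Qed.

Lemma vleN2 x y : (- x <= - y) = (y <= x).
Proof. by rewrite -[LHS]vsubr_ge0 opprK addrC vsubr_ge0. Qed.

Lemma vle_subLR x y z : (x - y <= z) = (x <= y + z).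
Proof. by rewrite -(vle_add2l y (x - y)) [y + (x - y)]addrC subrK. Qed.

Lemma vscale_ge0 a x : 0 <= a -> 0 <= x -> 0 <= a *: x.
Proof. exact: bscale_ge0. Qed.

Lemma vscale_le2 a x y : 0 <= a -> x <= y -> a *: x <= a *: y.
Proof. by move=> a0 xy; rewrite -vsubr_ge0 -scalerBr vscale_ge0 // vsubr_ge0. Qed.

Lemma vscale_le a b x : a <= b -> 0 <= x -> a *: x <= b *: x.
Proof. by move=> ab x0; rewrite -vsubr_ge0 -scalerBl vscale_ge0 // subr_ge0. Qed.

Lemma vmeetDr x y z : meet (x + z) (y + z) = meet x y + z.
Proof.
apply/le_anti/andP; split; last by rewrite lexI !vle_add2r leIl leIr.
by rewrite [leRHS]addrC -vle_subLR lexI !vle_subLR ![z + _]addrC leIl leIr.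
Qed.

Lemma voppI x y : - meet x y = join (- x) (- y).
Proof.
apply/le_anti/andP; split; last by rewrite leUx !vleN2 leIl leIr.
by rewrite -[join _ _]opprK vleN2 lexI -vleN2 opprK leUl -vleN2 opprK leUr.
Qed.

Lemma voppU x y : - join x y = meet (- x) (- y).
Proof. by apply: oppr_inj; rewrite voppI !opprK. Qed.

Lemma vjoinDr x y z : join (x + z) (y + z) = join x y + z.
Proof.
by apply: oppr_inj; rewrite opprD !voppU !opprD vmeetDr.
Qed.

Lemma vsubI x y : x - meet x y = join (x - y) 0.
Proof.
by rewrite voppI addrC -vjoinDr addNr [- y + x]addrC joinC.
Qed.

Lemma vaddUI x y : join x y + meet x y = x + y.
Proof.
have /(congr1 (+%R^~ x)) := vsubI y x; rewrite /= -vjoinDr subrK add0r => h.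
by rewrite joinC meetC -h addrAC subrK addrC.
Qed.

Lemma vscaleI a x y : 0 < a -> a *: meet x y = meet (a *: x) (a *: y).
Proof.
move=> a0; have a0' := ltW a0; have ai0 : 0 <= a^-1 by rewrite invr_ge0.
apply/le_anti/andP; split; first by rewrite lexI !vscale_le2 ?leIl ?leIr.
have -> : meet (a *: x) (a *: y) = a *: (a^-1 *: meet (a *: x) (a *: y)).
  by rewrite scalerA divff ?scale1r ?gt_eqF.
apply: vscale_le2 => //; rewrite lexI.
have K z : z = a^-1 *: (a *: z) by rewrite scalerA mulVf ?scale1r ?gt_eqF.
by apply/andP; split; rewrite [leRHS]K vscale_le2 ?leIl ?leIr.
Qed.

Lemma vaddr_ge0 x y : 0 <= x -> 0 <= y -> 0 <= x + y.
Proof. by move=> x0 y0; rewrite -[0]addr0 vleD. Qed.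

(** Twice the modulus dominates [x + (- x) = 0]; halving preserves the order. *)
Lemma modulus_ge0 x : 0 <= modulus x.
Proof.
have h : 0 <= modulus x + modulus x.
  by rewrite -(subrr x) vleD ?leUl ?leUr.
rewrite -[modulus x]scale1r.
have -> : (1 : R) = 2^-1 + 2^-1 by lra.
by rewrite scalerDl -scalerDr vscale_ge0.
Qed.

Lemma modulusN x : modulus (- x) = modulus x.
Proof. by rewrite /modulus opprK joinC. Qed.

Lemma ge0_modulus x : 0 <= x -> modulus x = x.
Proof.
move=> x0; apply/le_anti; rewrite leUl leUx lexx /= andbT.
by rewrite (le_trans _ x0) // -oppr0 vleN2.
Qed.

Lemma modulus_le x u : (modulus x <= u) = (x <= u) && (- x <= u).
Proof. exact: leUx. Qed.

Lemma le_modulus x : x <= modulus x.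
Proof. exact: leUl. Qed.

Lemma leN_modulus x : - x <= modulus x.
Proof. exact: leUr. Qed.

Lemma modulusD x y : modulus (x + y) <= modulus x + modulus y.
Proof. by rewrite modulus_le opprD !vleD ?le_modulus ?leN_modulus. Qed.

Lemma modulus_addKr x y : modulus x <= modulus (x + y) + modulus y.
Proof. by rewrite -{1}(addrK y x) (le_trans (modulusD _ _)) // modulusN. Qed.

Lemma modulusZ_le a x : modulus (a *: x) <= `|a| *: modulus x.
Proof.
rewrite modulus_le -scaleNr.
have h b : `|b| = `|a| -> b *: x <= `|a| *: modulus x.
  move=> <-; have [b0|b0] := leP 0 b.
    by rewrite ger0_norm // vscale_le2 // le_modulus.
  rewrite ltr0_norm // -[X in X *: x]opprK scaleNr -scalerN.
  by rewrite vscale_le2 ?leN_modulus // oppr_ge0 ltW.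
by rewrite !h ?normrN.
Qed.

Lemma modulusZ a x : modulus (a *: x) = `|a| *: modulus x.
Proof.
apply/le_anti; rewrite modulusZ_le /=.
have [->|a0] := eqVneq a 0; first by rewrite normr0 !scale0r modulus_ge0.
(* The reverse inequality is [modulusZ_le] for [a^-1] and [a *: x], rescaled. *)
have := vscale_le2 (normr_ge0 a) (modulusZ_le a^-1 (a *: x)).
by rewrite !scalerA normfV divff ?normr_eq0 // mulVf // !scale1r.
Qed.

Lemma norm_le_modulus x y : modulus x <= modulus y -> `|x| <= `|y|.
Proof. exact: ble_norm. Qed.

Lemma norm_modulus x : `|modulus x| = `|x|.
Proof.
have h : modulus (modulus x) = modulus x by rewrite ge0_modulus ?modulus_ge0.
by apply/le_anti; rewrite !norm_le_modulus ?h.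
Qed.

Lemma norm_le x y : 0 <= x -> x <= y -> `|x| <= `|y|.
Proof.
move=> x0 xy; apply: norm_le_modulus.
by rewrite !ge0_modulus // (le_trans x0).
Qed.

(** * Disjointness of positive vectors *)

Lemma vmeet_ge0 x y : 0 <= x -> 0 <= y -> 0 <= meet x y.
Proof. by move=> x0 y0; rewrite lexI x0. Qed.

(** After moving [meet u v] to the left, the bound by [u] is immediate and the bound by [w] follows
    from [meet u v + w = meet (u + w) (v + w)]. This makes disjointness stable under sums. *)
Lemma meet_subadd u v w : 0 <= u -> 0 <= v -> 0 <= w ->
  meet u (v + w) <= meet u v + meet u w.
Proof.
move=> u0 v0 w0; rewrite -vle_subLR lexI !vle_subLR.
apply/andP; split.
  by rewrite (le_trans (leIl _ _)) // -[leLHS]add0r vle_add2r vmeet_ge0.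
rewrite -vmeetDr lexI leIr andbT (le_trans (leIl _ _)) //.
by rewrite -[leLHS]addr0 vle_add2l.
Qed.

Lemma meet0S x y u v : 0 <= u -> 0 <= v -> u <= x -> v <= y ->
  meet x y = 0 -> meet u v = 0.
Proof.
move=> u0 v0 ux vy xy; apply/le_anti; rewrite vmeet_ge0 // andbT -xy.
exact: leI2.
Qed.

Lemma meet0D u v w : 0 <= u -> 0 <= v -> 0 <= w ->
  meet u v = 0 -> meet u w = 0 -> meet u (v + w) = 0.
Proof.
move=> u0 v0 w0 uv uw; apply/le_anti.
by rewrite vmeet_ge0 ?vaddr_ge0 // (le_trans (meet_subadd _ _ _)) // uv uw addr0.
Qed.

Lemma meet0Z a b u v : 0 <= a -> 0 <= b -> 0 <= u -> 0 <= v ->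
  meet u v = 0 -> meet (a *: u) (b *: v) = 0.
Proof.
move=> a0 b0 u0 v0 uv.
(* A common factor dominating both scalars; the [+ 1] keeps it positive when both vanish, as
   [vscaleI] requires. *)
have t0 : 0 < a + b + 1 by lra.
have at_ : a <= a + b + 1 by lra.
have bt : b <= a + b + 1 by lra.
apply: (@meet0S ((a + b + 1) *: u) ((a + b + 1) *: v));
  rewrite ?vscale_ge0 ?vscale_le //.
by rewrite -vscaleI // uv scaler0.
Qed.

Lemma meet0_addE x y : meet x y = 0 -> x + y = join x y.
Proof. by move=> xy; rewrite -vaddUI xy addr0. Qed.

(** Meeting [modulus (x + y) + modulus y] with [modulus x] removes the second term, which is
    disjoint from [modulus x]. *)
Lemma le_modulus_addr x y : meet (modulus x) (modulus y) = 0 ->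
  modulus x <= modulus (x + y).
Proof.
move=> xy; rewrite (le_trans (y := meet (modulus x) (modulus (x + y) + modulus y))) //.
  by rewrite lexI lexx modulus_addKr.
rewrite (le_trans (meet_subadd _ _ _)) ?modulus_ge0 // xy addr0.
exact: leIr.
Qed.

Lemma vsub_meet_disjoint x y :
  meet (x - meet x y) (y - meet x y) = 0.
Proof. by rewrite vmeetDr subrr. Qed.

(** [x - meet x y] is the positive part of [x - y]. *)
Lemma vsub_meet_le x y z : 0 <= z -> x <= y + z -> x - meet x y <= z.
Proof. by move=> z0 xyz; rewrite vsubI leUx z0 vle_subLR xyz. Qed.

(** * Finite disjoint families of positive vectors *)

(** Zero entries are allowed and may repeat, so truncating the members keeps a family disjoint in
    this sense. *)
Definition disjoint_list (s : seq X) :=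
  all (fun z => 0 <= z) s && pairwise (fun z w => meet z w == 0) s.

Lemma disjoint_list_cons z s : disjoint_list (z :: s) =
  [&& 0 <= z, all (fun w => meet z w == 0) s & disjoint_list s].
Proof. by rewrite /disjoint_list /= -!andbA; do !bool_congr. Qed.

Lemma sum_all_ge0 s : all (fun z : X => 0 <= z) s -> 0 <= \sum_(z <- s) z.
Proof.
elim: s => [|z s IH] /=; first by rewrite big_nil.
by move=> /andP[z0 /IH s0]; rewrite big_cons vaddr_ge0.
Qed.

Lemma disjoint_list_sum_ge0 s : disjoint_list s -> 0 <= \sum_(z <- s) z.
Proof. by move=> /andP[/sum_all_ge0]. Qed.

Lemma meet0_sum u s : 0 <= u -> all (fun z => 0 <= z) s ->
  all (fun z => meet u z == 0) s -> meet u (\sum_(z <- s) z) = 0.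
Proof.
move=> u0; elim: s => [|z s IH] /=.
  by rewrite big_nil => _ _; apply/le_anti; rewrite leIr lexI u0 lexx.
move=> /andP[z0 s0] /andP[/eqP uz us]; rewrite big_cons meet0D ?IH //.
exact: sum_all_ge0.
Qed.

(** A disjoint sum is a join ([meet0_addE]), so bounding the members one by one suffices. *)
Lemma disjoint_list_sum_le u s : 0 <= u -> disjoint_list s ->
  all (fun z => z <= u) s -> \sum_(z <- s) z <= u.
Proof.
move=> u0; elim: s => [|z s IH]; first by rewrite big_nil.
rewrite disjoint_list_cons big_cons /= => /and3P[z0 zs ds] /andP[zu su].
have s0 : all (fun z => 0 <= z) s by case/andP: ds.
by rewrite meet0_addE ?meet0_sum // leUx zu IH.
Qed.

Lemma disjoint_list_map (f : X -> X) s :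
  (forall z, z \in s -> 0 <= f z <= z) -> disjoint_list s ->
  disjoint_list (map f s).
Proof.
elim: s => // z s IH fz; rewrite /= !disjoint_list_cons => /and3P[z0 zs ds].
have /andP[fz0 fzz] := fz z (mem_head _ _).
rewrite fz0 IH ?andbT //=; last by move=> w ws; rewrite fz // inE ws orbT.
rewrite all_map; apply/allP => w ws /=; apply/eqP.
have /andP[fw0 fww] : 0 <= f w <= w by rewrite fz // inE ws orbT.
by apply: (meet0S fz0 fw0 fzz fww); apply/eqP; exact: (allP zs).
Qed.

Lemma disjoint_listZ a s : 0 <= a -> disjoint_list s ->
  disjoint_list [seq a *: z | z <- s].
Proof.
move=> a0; elim: s => // z s IH; rewrite /= !disjoint_list_cons.
move=> /and3P[z0 zs ds]; rewrite vscale_ge0 //= IH // andbT.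
rewrite all_map; apply/allP => w ws /=; apply/eqP.
case/andP: ds => /allP /(_ _ ws) w0 _.
by apply: meet0Z => //; apply/eqP; exact: (allP zs).
Qed.

Lemma disjoint_list_filter p s : disjoint_list s -> disjoint_list (seq.filter p s).
Proof.
move=> /andP[s0 ds]; apply/andP; split; last first.
  exact: subseq_pairwise (filter_subseq _ _) ds.
by rewrite all_filter; apply: sub_all s0 => z z0 /=; rewrite z0 implybT.
Qed.

Lemma disjoint_list_cat s t : disjoint_list s -> disjoint_list t ->
  meet (\sum_(z <- s) z) (\sum_(z <- t) z) = 0 -> disjoint_list (s ++ t).
Proof.
move=> ds dt; have t0 := disjoint_list_sum_ge0 dt.
elim: s ds => //= z s IH; rewrite !disjoint_list_cons big_cons.
move=> /and3P[z0 zs ds] st; have s0 := disjoint_list_sum_ge0 ds.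
rewrite z0 IH //; last first.
  by apply: meet0S st => //; rewrite -[leLHS]add0r vle_add2r.
rewrite all_cat zs andbT /=; apply/allP => w wt; apply/eqP.
have w0 : 0 <= w by case/andP: dt => /allP /(_ _ wt).
apply: meet0S st => //; first by rewrite -[leLHS]addr0 vle_add2l.
rewrite (perm_big _ (perm_to_rem wt)) big_cons -[leLHS]addr0 vle_add2l.
apply: sum_all_ge0; apply/allP => v /mem_rem vt.
by case/andP: dt => /allP /(_ _ vt).
Qed.

Lemma disjoint_list_catW s t : disjoint_list (s ++ t) ->
  [/\ disjoint_list s, disjoint_list t &
      meet (\sum_(z <- s) z) (\sum_(z <- t) z) = 0].
Proof.
elim: s => [|z s IH] /=.
  move=> dt; split=> //; rewrite big_nil.
  by apply/le_anti; rewrite leIl lexI lexx disjoint_list_sum_ge0.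
rewrite !disjoint_list_cons all_cat => /and3P[z0 /andP[zs zt] /IH[ds dt st]].
split=> //; first by rewrite z0 zs.
have t0 : all (fun w => 0 <= w) t by case/andP: dt.
rewrite big_cons meetC meet0D ?disjoint_list_sum_ge0 //; last by rewrite meetC.
by rewrite meetC meet0_sum.
Qed.

Lemma mem_le_sum s w : disjoint_list s -> w \in s -> w <= \sum_(z <- s) z.
Proof.
move=> /andP[s0 _] ws; rewrite (perm_big _ (perm_to_rem ws)) big_cons.
rewrite -[leLHS]addr0 vle_add2l sum_all_ge0 //; apply/allP => v /mem_rem.
exact: (allP s0).
Qed.

Lemma sum_filter_le p s : disjoint_list s ->
  \sum_(z <- seq.filter p s) z <= \sum_(z <- s) z.
Proof.
move=> ds; rewrite [leRHS](bigID p) /= -[X in X + _]big_filter.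
rewrite -[leLHS]addr0 vle_add2l -big_filter.
exact/disjoint_list_sum_ge0/disjoint_list_filter.
Qed.

(** * Norm growth of disjoint sums and the lower estimate *)

(** The witness lists the sums of the consecutive blocks of length [k]. *)
Lemma disjoint_list_regroup (k m : nat) (t T : R) s :
  (forall r, size r = k -> disjoint_list r -> all (fun z => t <= `|z|) r ->
    T <= `|\sum_(z <- r) z|) ->
  size s = (m * k)%N -> disjoint_list s -> all (fun z => t <= `|z|) s ->
  exists s', [/\ size s' = m, disjoint_list s',
    all (fun z => T <= `|z|) s' & \sum_(z <- s') z = \sum_(z <- s) z].
Proof.
move=> kT; elim: m s => [|m IH] s.
  by rewrite mul0n => /size0nil -> _ _; exists [::].
rewrite mulSn => sz; rewrite -[s in disjoint_list s](cat_take_drop k).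
rewrite -[s in all _ s](cat_take_drop k).
move=> /disjoint_list_catW[dk ds0 mk]; rewrite all_cat => /andP[tk ts].
have szk : size (take k s) = k by rewrite size_takel // sz leq_addr.
have [|s' [sz' ds' Ts' es']] := IH (drop k s) _ ds0 ts.
  by rewrite size_drop sz addKn.
exists ((\sum_(z <- take k s) z) :: s'); split.
- by rewrite /= sz'.
- rewrite disjoint_list_cons disjoint_list_sum_ge0 // ds' andbT /=.
  apply/allP => w ws'; apply/eqP; move: mk; rewrite -es'; apply: meet0S => //.
  + exact: disjoint_list_sum_ge0.
  + by case/andP: ds' => /allP /(_ _ ws').
  + exact: mem_le_sum.
- by rewrite /= kT.
- by rewrite big_cons es' -[in RHS](cat_take_drop k s) big_cat.
Qed.

(** For the step, [n ^ j.+1] vectors form [n] blocks of [n ^ j]. The block sums have norm at least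
    [T = 2 ^+ j * t], so after division by [T] the hypothesis applies to them and doubles the
    bound. *)
Lemma disjoint_list_growth (n : nat) :
  (forall s, size s = n -> disjoint_list s -> all (fun z => 1 <= `|z|) s ->
    2 <= `|\sum_(z <- s) z|) ->
  forall (j : nat) s (t : R), 0 < t -> size s = (n ^ j)%N -> disjoint_list s ->
    all (fun z => t <= `|z|) s -> 2 ^+ j * t <= `|\sum_(z <- s) z|.
Proof.
move=> hn; elim=> [|j IH] s t t0 sz ds ts.
  case: s sz ds ts => [|z [|//]] //= _ _.
  by rewrite andbT big_seq1 expr0 mul1r.
have [] := @disjoint_list_regroup (n ^ j) n t (2 ^+ j * t) s; rewrite -?expnS //.
  by move=> r; exact: IH.
move=> s' [sz' ds' Ts' <-].
have T0 : 0 < 2 ^+ j * t by rewrite mulr_gt0 ?exprn_gt0.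
set T := 2 ^+ j * t in T0 Ts'.
have /hn : size [seq T^-1 *: z | z <- s'] = n by rewrite size_map.
have Tv : 0 <= T^-1 by rewrite invr_ge0 ltW.
move=> /(_ (disjoint_listZ Tv ds')); rewrite all_map big_map -scaler_sumr normrZ.
rewrite gtr0_norm ?invr_gt0 // => h.
have {h} : 2 <= T^-1 * `|\sum_(z <- s') z|.
  apply: h; apply: sub_all Ts' => z /= Tz.
  by rewrite normrZ gtr0_norm ?invr_gt0 // ler_pdivlMl ?mulr1.
by rewrite ler_pdivlMl // exprS -mulrA mulrC.
Qed.

(** Otherwise [n ^ K.+2] of these members would have a sum of norm at least 2^(K+2) / 2^(K+1) = 2,
    although the whole sum has norm at most 1. *)
Lemma disjoint_list_count (n K : nat) s :
  (forall s, size s = n -> disjoint_list s -> all (fun z => 1 <= `|z|) s ->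
    2 <= `|\sum_(z <- s) z|) ->
  disjoint_list s -> `|\sum_(z <- s) z| <= 1 ->
  (count (fun z => 2 ^- K.+1 < `|z|)%R s <= n ^ K.+2)%N.
Proof.
move=> hn ds s1; rewrite leqNgt; apply/negP => big.
set p := (fun z => _) in big; set r := take (n ^ K.+2) (seq.filter p s).
have K0 : 0 < 2 ^- K.+1 :> R by rewrite invr_gt0 exprn_gt0.
have dfs := disjoint_list_filter p ds.
have := dfs; rewrite -[X in disjoint_list X](cat_take_drop (n ^ K.+2)).
move=> /disjoint_list_catW[dr dd _].
have rs : \sum_(z <- r) z <= \sum_(z <- s) z.
  apply: le_trans (sum_filter_le p ds).
  rewrite -[in leRHS](cat_take_drop (n ^ K.+2) (seq.filter p s)) big_cat /=.
  by rewrite -[leLHS]addr0 vle_add2l disjoint_list_sum_ge0.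
have sr : size r = (n ^ K.+2)%N by rewrite size_takel // size_filter ltnW.
have := disjoint_list_growth hn K0 sr dr.
rewrite (exprS (2 : R) K.+1) -mulrA divff ?mulr1; last by rewrite expf_neq0.
apply: contraPP => _; apply/not_implyP; split; last first.
  apply/negP; rewrite -ltNge.
  rewrite (le_lt_trans (norm_le (disjoint_list_sum_ge0 dr) rs)) //.
  by rewrite (le_lt_trans s1) // ltr1n.
apply/allP => z /mem_take; rewrite mem_filter => /andP[pz _]; exact: ltW.
Qed.

(* At most [n ^ (K + 2)] members have norm in the dyadic shell
   [(2^-(K+1), 2^-K]], and the exponent [n] is large enough since [2 * n <= 2 ^ n]. *)
Lemma lower_estimate_level (n K : nat) s : (0 < n)%N ->
  (forall s, size s = n -> disjoint_list s -> all (fun z => 1 <= `|z|) s ->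
    2 <= `|\sum_(z <- s) z|) ->
  disjoint_list s -> `|\sum_(z <- s) z| <= 1 ->
  \sum_(z <- s | (2 ^- K < `|z|)%R) `|z| ^+ n <= 2 * n%:R ^+ 2 * (1 - 2 ^- K).
Proof.
move=> n0 hn ds s1; elim: K => [|K IH].
  (* At level 0 there are no terms: each member is below the sum, hence of norm at most 1. *)
  rewrite expr0 invr1 subrr mulr0 big1_seq // => z /andP[z1 zs].
  have z0 : 0 <= z by case/andP: ds => /allP /(_ _ zs).
  have := le_trans (norm_le z0 (mem_le_sum ds zs)) s1.
  by rewrite leNgt z1.
have K0 : 0 < 2 ^- K :> R by rewrite invr_gt0 exprn_gt0.
have KS : 2 ^- K.+1 = 2 ^- K / 2 :> R by rewrite exprS invfM mulrC.
rewrite (bigID (fun z => (2 ^- K < `|z|)%R)) /=.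
have -> : \sum_(z <- s | (2 ^- K.+1 < `|z|)%R && (2 ^- K < `|z|)%R) `|z| ^+ n =
    \sum_(z <- s | (2 ^- K < `|z|)%R) `|z| ^+ n.
  apply: eq_bigl => z; case: (ltP (2 ^- K) `|z|) => h; rewrite ?andbF //.
  by rewrite andbT (lt_trans _ h) // KS; lra.
(* The allowance n^2 / 2^K for the new shell is exactly the increase of the right-hand side from
   level [K] to [K.+1]. *)
apply: le_trans (lerD IH (_ : _ <= n%:R ^+ 2 * 2 ^- K)) _; last first.
  by rewrite KS; lra.
apply: (@le_trans _ _ (\sum_(z <- s | (2 ^- K.+1 < `|z|)%R) (2 ^- K) ^+ n)).
  rewrite [leRHS](bigID (fun z => (2 ^- K < `|z|)%R)) /= -[leLHS]add0r lerD //.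
    by apply: sumr_ge0 => *; rewrite exprn_ge0 // ltW.
  apply: ler_sum => z /andP[_]; rewrite -leNgt => zK.
  by rewrite lerXn2r ?nnegrE // ltW.
rewrite big_const_seq iter_addr_0 -[leLHS]mulr_natl.
apply: (@le_trans _ _ ((n ^ K.+2)%:R * (2 ^- K) ^+ n)).
  rewrite ler_wpM2r ?ler_nat ?(exprn_ge0 _ (ltW K0)) //.
  exact: disjoint_list_count.
(* The bound is regrouped as n^2 (n / 2^n)^K, where n / 2^n <= 1/2. *)
rewrite natrX -!exprVn -exprM mulnC exprM -addn2 exprD mulrC mulrA.
rewrite mulrC ler_wpM2l ?exprn_ge0 //.
rewrite -exprMn lerXn2r ?nnegrE ?mulr_ge0 ?exprn_ge0 ?invr_ge0 //.
rewrite exprVn ler_pdivrMl ?exprn_gt0 //.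
have : (n%:R * 2 <= 2 ^+ n :> R).
  rewrite -natrX -natrM ler_nat.
  by case: n n0 {hn IH} => // n _; rewrite expnS mulnC leq_mul2l /= ltn_expl.
by lra.
Qed.

(** Finitely many nonzero norms have a positive lower bound, so one level captures every term that
    contributes to the power sum. *)
Lemma exists_level s : exists K : nat,
  all (fun z => (z == 0) || (2 ^- K < `|z|)%R) s.
Proof.
elim: s => [|z s [K hK]]; first by exists 0%N.
have [L hL] : exists L : nat, (z == 0) || (2 ^- L < `|z|)%R.
  have [->|z0] := eqVneq z 0; first by exists 0%N.
  exists (Num.bound (`|z|^-1)); rewrite -ltf_pV2 ?posrE ?normr_gt0 //;
    rewrite ?invr_gt0 ?exprn_gt0 // invrK.
  apply: lt_trans (archi_boundP _) _; rewrite ?invr_ge0 //.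
  by rewrite -natrX ltr_nat ltn_expl.
have mono (a b : nat) (w : X) : (w == 0) || (2 ^- a < `|w|)%R ->
    (w == 0) || (2 ^- (a + b) < `|w|)%R.
  move=> /orP[->//|h]; apply/orP; right; apply: le_lt_trans h.
  by rewrite lef_pV2 ?posrE ?exprn_gt0 // ler_eXn2l ?ltr1n // leq_addr.
exists (L + K)%N => /=; rewrite mono //=.
by apply: sub_all hK => w /(mono K L); rewrite addnC.
Qed.

(** The level bounds are at most 2 n^2 for every [K], which settles families whose sum has norm at
    most 1; homogeneity gives the rest. *)
Lemma lower_estimate (n : nat) s : (0 < n)%N ->
  (forall s, size s = n -> disjoint_list s -> all (fun z => 1 <= `|z|) s ->
    2 <= `|\sum_(z <- s) z|) ->
  disjoint_list s ->
  \sum_(z <- s) `|z| ^+ n <= 2 * n%:R ^+ 2 * `|\sum_(z <- s) z| ^+ n.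
Proof.
move=> n0 hn.
have unit_case r : disjoint_list r -> `|\sum_(z <- r) z| <= 1 ->
    \sum_(z <- r) `|z| ^+ n <= 2 * n%:R ^+ 2.
  move=> dr r1; have [K /allP hK] := exists_level r.
  apply: (@le_trans _ _ (2 * n%:R ^+ 2 * (1 - 2 ^- K))); last first.
    have K0 : 0 <= 2 ^- K :> R by rewrite invr_ge0 exprn_ge0.
    by rewrite ler_piMr ?mulr_ge0 ?exprn_ge0 //; lra.
  apply: le_trans (lower_estimate_level K n0 hn dr r1).
  rewrite [leLHS](bigID (fun z => (2 ^- K < `|z|)%R)) /= [X in _ + X]big1_seq ?addr0 //.
  move=> z /andP[zK /hK]; rewrite (negPf zK) orbF => /eqP ->.
  by rewrite normr0 expr0n gtn_eqF.
move=> ds; set S := \sum_(z <- s) z.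
(* A zero sum cannot be normalized, but then all members, being below it, vanish. *)
have [S0|S0] := eqVneq `|S| 0.
  rewrite S0 expr0n gtn_eqF // mulr0 big1_seq // => z /andP[_ zs].
  have z0 : 0 <= z by case/andP: ds => /allP /(_ _ zs).
  have := norm_le z0 (mem_le_sum ds zs); rewrite S0 normr_le0 => /eqP ->.
  by rewrite normr0 expr0n gtn_eqF.
have Sp : 0 < `|S| by rewrite lt_def S0 /=.
have Sv : 0 <= `|S|^-1 by rewrite invr_ge0.
have := unit_case _ (disjoint_listZ Sv ds).
rewrite !big_map -scaler_sumr normrZ ger0_norm // mulVf // lexx => /(_ isT).
under eq_bigr do rewrite normrZ (ger0_norm Sv) exprMn.
by rewrite -mulr_sumr exprVn ler_pdivrMl ?exprn_gt0 // mulrC.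
Qed.

(** * Disjoint vectors and copies of l_oo^n *)

Lemma modulus_comb_le (n : nat) (z : 'I_n -> X) (c : 'I_n -> R) (M : R) :
  (forall i, 0 <= z i) -> (forall i, `|c i| <= M) ->
  modulus (\sum_i c i *: z i) <= M *: \sum_i z i.
Proof.
move=> z0 cM; rewrite scaler_sumr.
elim/big_ind2 : _ => [|x u y v xu yv|i _].
- by rewrite ge0_modulus.
- by rewrite (le_trans (modulusD _ _)) ?vleD.
- by rewrite modulusZ ge0_modulus ?vscale_le.
Qed.

(** The term [c i *: z i] is disjoint from the rest of the sum, so [le_modulus_addr] applies. *)
Lemma disjoint_comb_ge (n : nat) (z : 'I_n -> X) (c : 'I_n -> R) (i : 'I_n) :
  (forall i, 0 <= z i) -> (forall i j, i != j -> meet (z i) (z j) = 0) ->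
  1 <= `|z i| -> `|c i| <= `|\sum_j c j *: z j|.
Proof.
move=> z0 dz zi; apply: (@le_trans _ _ `|c i *: z i|).
  by rewrite normrZ ler_peMr.
rewrite (bigD1 i) //=; apply/norm_le_modulus/le_modulus_addr.
elim/big_ind: _ => [|x y dx dy|j ji].
- rewrite [modulus 0]ge0_modulus // meetC.
  by apply/le_anti; rewrite leIl vmeet_ge0 ?modulus_ge0.
- apply: (@meet0S (modulus (c i *: z i)) (modulus x + modulus y));
    rewrite ?modulus_ge0 ?modulusD ?lexx //.
  by rewrite meet0D ?modulus_ge0.
- by rewrite !modulusZ !ge0_modulus // meet0Z // dz // eq_sym.
Qed.

Lemma disjoint_list_nth (s : seq X) (i j : 'I_(size s)) : disjoint_list s ->
  i != j -> meet (nth 0 s i) (nth 0 s j) = 0.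
Proof.
move=> /andP[_ /(pairwiseP 0) ds].
wlog ij : i j / (i < j)%N => [hw|_].
  have [ij|ij|/val_inj ->] := ltngtP i j; last by rewrite eqxx.
    exact: hw.
  by rewrite eq_sym meetC; exact: hw.
by apply/eqP; apply: ds; rewrite ?inE.
Qed.

Lemma le_mx_norm (n : nat) (c : 'rV[R]_n) i : `|c 0 i| <= `|c|.
Proof.
rewrite /Num.norm /= mx_normrE.
exact: (@le_bigmax _ _ _ _ _ (0, i)).
Qed.

Lemma mx_norm_le (n : nat) (c : 'rV[R]_n) (M : R) : 0 <= M ->
  (forall i, `|c 0 i| <= M) -> `|c| <= M.
Proof.
move=> M0 cM; rewrite /Num.norm /= mx_normrE.
by apply/bigmax_leP; split=> // -[i j] _; rewrite /= [i]ord1.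
Qed.

(** [D 0] excludes the empty supremum, which is -oo. Nonnegativity is what allows bounds on two
    operator norms to be multiplied. *)
Lemma opnorm_ge0 (V W : normedModType R) (D : set V) (f : V -> W) :
  D 0 -> (0 <= opnorm D f)%E.
Proof.
move=> D0; apply: (@le_trans _ _ `|f 0|%:E); first by rewrite lee_fin.
by apply: ereal_sup_ubound; exists 0 => //=; rewrite normr0.
Qed.

Lemma opnorm_le (V W : normedModType R) (D : set V) (f : V -> W) (M : R) :
  (forall x : V, D x -> `|x| <= 1 -> `|f x| <= M) -> (opnorm D f <= M%:E)%E.
Proof.
by move=> fM; apply: ge_ereal_sup => _ [x [Dx x1] <-]; rewrite lee_fin fM.
Qed.

(* The span is [l_oo^n]: [|c i| <= |T c|] gives [|T^-1| <= 1], and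
   [|T c| <= |c| * |sum z|] gives [|T| <= 2]. *)
Lemma linfty_copy_disjoint (s : seq X) : disjoint_list s ->
  all (fun z => 1 <= `|z|) s -> `|\sum_(z <- s) z| <= 2 ->
  linfty_copy X 2 (size s).
Proof.
move=> ds s1 s2; set n := size s; pose z (i : 'I_n) := nth 0 s i.
have z0 i : 0 <= z i by case/andP: ds => /(all_nthP 0) + _; apply.
have z1 i : 1 <= `|z i| by move/(all_nthP 0): s1; apply.
have dz i j : i != j -> meet (z i) (z j) = 0 by exact: disjoint_list_nth.
have {s2} s2 : `|\sum_i z i| <= 2 by move: s2; rewrite (big_nth 0) big_mkord.
pose T (c : 'rV[R]_n) := \sum_i c 0 i *: z i.
have Tlin : linear T.
  move=> a c d; rewrite /T scaler_sumr -big_split; apply: eq_bigr => i _ /=.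
  by rewrite !mxE scalerDl scalerA.
pose TL : {linear 'rV[R]_n -> X} :=
  HB.pack_for {linear 'rV[R]_n -> X} T
    (GRing.isLinear.Build _ _ _ _ T Tlin).
have TE c : T (\row_i c i) = \sum_i c i *: z i.
  by apply: eq_bigr => i _; rewrite mxE.
have Tge c : `|c| <= `|T c| by apply: mx_norm_le => // i; exact: disjoint_comb_ge.
have Tinj : injective T.
  move=> c d /eqP; rewrite -subr_eq0 => cd; apply/eqP; rewrite -subr_eq0.
  rewrite -normr_le0 (le_trans (Tge _)) // -[T]/(TL : _ -> _) linearB.
  by rewrite (eqP cd) normr0.
(* A preimage by choice, with default 0 off the range of [T]; injectivity makes it a left
   inverse. *)
pose S x := xget 0 [set c | T c = x]%classic.
have TK : cancel T S by move=> c; apply: xget_unique => // d; exact: Tinj.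
exists [set \sum_i c i *: z i | c in [set: 'I_n -> R]]%classic, TL, S; split => //.
- exists z; split=> // c c0 i; apply/eqP; rewrite -normr_le0.
  by rewrite (le_trans (disjoint_comb_ge c z0 dz (z1 i))) // c0 normr0.
- split.
  + by move=> c _; exists (fun i => c 0 i).
  + by move=> c d _ _; exact: Tinj.
  + by move=> _ [c _ <-]; exists (\row_i c i) => //; exact: TE.
- have -> : 2%:E = (2%:E * 1%:E)%E :> \bar R by rewrite mule1.
  apply: lee_pmul.
  + exact: opnorm_ge0.
  + apply: opnorm_ge0; exists (fun=> 0) => //.
    by rewrite big1 // => i _; rewrite scale0r.
  + apply: opnorm_le => c _ c1; apply: le_trans s2.
    apply: norm_le_modulus; rewrite [leRHS]ge0_modulus; last first.
      by elim/big_ind: _ => // *; exact: vaddr_ge0.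
    rewrite -[leRHS]scale1r; apply: modulus_comb_le => // i.
    exact: le_trans (le_mx_norm _ _) c1.
  + apply: opnorm_le => _ [c _ <-] c1; rewrite -TE TK.
    by rewrite (le_trans (Tge _)) // TE.
Qed.

(** The constant 2 fails for some [n], and [linfty_copy_disjoint] is used in contrapositive form for
    that [n]. *)
Lemma not_linfty_lower_bound : ~ contains_linfty_uniformly X ->
  exists2 n : nat, (0 < n)%N &
    forall s, size s = n -> disjoint_list s -> all (fun z => 1 <= `|z|) s ->
      2 <= `|\sum_(z <- s) z|.
Proof.
move=> nX; have [n nn] : exists n, ~ linfty_copy X 2 n.
  by apply/existsNP => h; apply: nX; exists 2; rewrite ?ler1n.
have hn s : size s = n -> disjoint_list s -> all (fun z => 1 <= `|z|) s ->
    2 <= `|\sum_(z <- s) z|.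
  move=> sn ds s1; rewrite leNgt; apply/negP => s2; apply: nn; rewrite -sn.
  exact/linfty_copy_disjoint/ltW.
(* For [n = 0] the empty family would give 2 <= 0. *)
exists n => //; case: n hn {nn} => // /(_ [::] erefl isT isT).
by rewrite big_nil normr0 lern0.
Qed.

End VectorLattice.

(** * Convexity inequalities for integer powers *)

Section PowerSums.
Variable R : realType.
Implicit Types a b l m A B : R.

(** In the inductive step the gap is l m (a - b) (a^n - b^n), and the two differences never have
    opposite signs. *)
Lemma exprn_convex (n : nat) l m a b : 0 <= l -> 0 <= m -> l + m = 1 ->
  0 <= a -> 0 <= b -> (l * a + m * b) ^+ n <= l * a ^+ n + m * b ^+ n.
Proof.
move=> l0 m0 lm a0 b0; elim: n => [|n IH]; first by rewrite !expr0 !mulr1 lm.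
rewrite exprS; apply: (@le_trans _ _ ((l * a + m * b) * (l * a ^+ n + m * b ^+ n))).
  by rewrite ler_wpM2l // addr_ge0 ?mulr_ge0.
have h : 0 <= (a - b) * (a ^+ n - b ^+ n).
  have [ab|/ltW ba] := leP a b.
    by rewrite mulr_le0 // subr_le0 // lerXn2r.
  by rewrite mulr_ge0 // subr_ge0 // lerXn2r.
have {h} := mulr_ge0 (mulr_ge0 l0 m0) h; rewrite !exprS.
have -> : m = 1 - l by lra.
nra.
Qed.

(** Minkowski's inequality without roots: (f + g) / (A + B) is the convex combination of f / A and g
    / B with weights A / (A + B) and B / (A + B). *)
Lemma minkowski_seq (T : Type) (n : nat) (f g : T -> R) (s : seq T) A B :
  0 < A -> 0 < B -> (forall z, 0 <= f z) -> (forall z, 0 <= g z) ->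
  \sum_(z <- s) f z ^+ n <= A ^+ n -> \sum_(z <- s) g z ^+ n <= B ^+ n ->
  \sum_(z <- s) (f z + g z) ^+ n <= (A + B) ^+ n.
Proof.
move=> A0 B0 f0 g0 fA gB; have AB : 0 < A + B by rewrite addr_gt0.
pose l := A / (A + B); pose m := B / (A + B).
have lm : l + m = 1 by rewrite -mulrDl divff ?gt_eqF.
have l0 : 0 <= l by rewrite divr_ge0 ?ltW.
have m0 : 0 <= m by rewrite divr_ge0 ?ltW.
apply: (@le_trans _ _ ((A + B) ^+ n * (l * (\sum_(z <- s) f z ^+ n / A ^+ n)
    + m * (\sum_(z <- s) g z ^+ n / B ^+ n)))).
  rewrite !mulr_sumr -big_split mulr_sumr; apply: ler_sum => z _.
  have -> : f z + g z = (A + B) * (l * (f z / A) + m * (g z / B)).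
    by rewrite /l /m; field; rewrite !gt_eqF.
  rewrite exprMn ler_wpM2l ?(exprn_ge0 _ (ltW AB)) // -!expr_div_n.
  by apply: exprn_convex; rewrite ?divr_ge0 // ltW.
rewrite ler_piMr ?(exprn_ge0 _ (ltW AB)) // -lm -!mulr_suml lerD //.
  by rewrite ler_piMr // ler_pdivrMr ?exprn_gt0 // mul1r.
by rewrite ler_piMr // ler_pdivrMr ?exprn_gt0 // mul1r.
Qed.

(** Bernoulli's inequality, which converts a loss in the q-th power into a loss in the norm. *)
Lemma one_sub_exprn_le (n : nat) a : 0 <= a <= 1 -> 1 - a ^+ n <= n%:R * (1 - a).
Proof.
move=> /andP[a0 a1]; elim: n => [|n IH]; first by rewrite expr0 subrr mul0r.
have an : a ^+ n <= 1 by rewrite exprn_ile1.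
have an0 : 0 <= a ^+ n by rewrite exprn_ge0.
by rewrite exprS -natr1; nra.
Qed.

End PowerSums.

(** * The equivalent lattice norm built from disjoint power sums *)

Section Renorming.
Variables (R : realType) (X : banachLatticeType R) (q : nat) (C : R).
Hypothesis q0 : (0 < q)%N.
Hypothesis lower_est : forall s : seq X, disjoint_list s ->
  \sum_(z <- s) `|z| ^+ q <= C * `|\sum_(z <- s) z| ^+ q.
Implicit Types (x y z u v w : X) (s : seq X).

Definition packing x s := disjoint_list s /\ \sum_(z <- s) z <= modulus x.

Definition qsum s : R := \sum_(z <- s) `|z| ^+ q.

Definition lower_q_norm x : R :=
  sup [set qsum s | s in packing x]%classic `^ q%:R^-1.
Local Notation N := lower_q_norm.

Lemma packing_nil x : packing x [::].
Proof. by split=> //; rewrite big_nil modulus_ge0. Qed.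

(** The lower estimate enters here and makes the supremum defining the norm finite. The sign of [C]
    is not assumed, hence its absolute value. *)
Lemma packing_ub x s : packing x s -> qsum s <= `|C| * `|x| ^+ q.
Proof.
move=> [ds sx]; apply: le_trans (lower_est ds) _.
apply: (@le_trans _ _ (`|C| * `|\sum_(z <- s) z| ^+ q)).
  by rewrite ler_wpM2r ?exprn_ge0 // ler_norm.
rewrite ler_wpM2l // lerXn2r ?nnegrE // -[leRHS]norm_modulus norm_le //.
exact: disjoint_list_sum_ge0.
Qed.

Lemma qsum_le_sup x s : packing x s ->
  qsum s <= sup [set qsum s | s in packing x]%classic.
Proof.
move=> xs; apply: ub_le_sup; last by exists s.
by exists (`|C| * `|x| ^+ q) => _ [r xr <-]; exact: packing_ub.
Qed.

Lemma sup_qsum_ge0 x : 0 <= sup [set qsum s | s in packing x]%classic.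
Proof. by apply: le_trans (qsum_le_sup (packing_nil x)); rewrite /qsum big_nil. Qed.

Lemma lower_q_norm_ge0 x : 0 <= N x.
Proof. exact: powR_ge0. Qed.

Lemma lower_q_normX x : N x ^+ q = sup [set qsum s | s in packing x]%classic.
Proof.
by rewrite -powR_mulrn ?powR_ge0 // -powRrM mulVf ?powRr1 ?sup_qsum_ge0 //
  pnatr_eq0 gtn_eqF.
Qed.

Lemma qsum_le x s : packing x s -> qsum s <= N x ^+ q.
Proof. by rewrite lower_q_normX; exact: qsum_le_sup. Qed.

Lemma lower_q_norm_le x B : 0 <= B ->
  (forall s, packing x s -> qsum s <= B ^+ q) -> N x <= B.
Proof.
move=> B0 xB; rewrite -(@ler_pXn2r _ q) ?nnegrE ?lower_q_norm_ge0 //.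
rewrite lower_q_normX; apply: ge_sup.
  by exists (qsum [::]), [::] => //; exact: packing_nil.
by move=> _ [s xs <-]; exact: xB.
Qed.

Lemma lower_q_norm_mono x y : modulus x <= modulus y -> N x <= N y.
Proof.
move=> xy; apply: lower_q_norm_le; first exact: lower_q_norm_ge0.
by move=> s [ds sx]; apply: qsum_le; split=> //; exact: le_trans xy.
Qed.

Lemma lower_q_norm_modulus x : N (modulus x) = N x.
Proof.
by rewrite /lower_q_norm /packing [modulus (modulus x)]ge0_modulus ?modulus_ge0.
Qed.

Lemma lower_q_normN x : N (- x) = N x.
Proof. by rewrite /lower_q_norm /packing modulusN. Qed.

Lemma norm_le_lower_q_norm x : `|x| <= N x.
Proof.
rewrite -(@ler_pXn2r _ q) ?nnegrE ?lower_q_norm_ge0 //.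
have -> : `|x| ^+ q = qsum [:: modulus x] by rewrite /qsum big_seq1 norm_modulus.
apply: qsum_le; split; last by rewrite big_seq1.
by rewrite disjoint_list_cons modulus_ge0.
Qed.

Lemma lower_q_norm_le_norm x : N x <= (`|C| + 1) * `|x|.
Proof.
apply: lower_q_norm_le => [|s /packing_ub xs]; first by rewrite mulr_ge0 ?addr_ge0.
apply: le_trans xs _; rewrite exprMn ler_wpM2r ?exprn_ge0 //.
(* The constant is at least 1, hence at most its own q-th power; this avoids a root of [C]. *)
apply: (@le_trans _ _ (`|C| + 1)); first by rewrite lerDl.
by rewrite ler_eXnr // lerDr.
Qed.

Lemma lower_q_norm0 : N 0 = 0.
Proof.
apply/le_anti; rewrite lower_q_norm_ge0 andbT.
by rewrite (le_trans (lower_q_norm_le_norm 0)) // normr0 mulr0.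
Qed.

Lemma lower_q_normD x y : N (x + y) <= N x + N y.
Proof.
(* Zero vectors are set aside because [minkowski_seq] needs positive bounds. *)
have [->|x0] := eqVneq x 0; first by rewrite add0r lower_q_norm0 add0r.
have [->|y0] := eqVneq y 0; first by rewrite addr0 lower_q_norm0 addr0.
have Nx : 0 < N x by rewrite (lt_le_trans _ (norm_le_lower_q_norm x)) ?normr_gt0.
have Ny : 0 < N y by rewrite (lt_le_trans _ (norm_le_lower_q_norm y)) ?normr_gt0.
apply: lower_q_norm_le => [|s [ds sxy]]; first by rewrite addr_ge0 // ltW.
have s0 z : z \in s -> 0 <= z by case/andP: ds => /allP s0 _; exact: s0.
(* Riesz decomposition: a packing of x + y splits into packings of x and y. *)
pose f z := meet z (modulus x); pose g z := z - f z.
have df : disjoint_list (map f s).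
  apply: disjoint_list_map ds => z /s0 z0.
  by rewrite vmeet_ge0 ?modulus_ge0 //= leIl.
have dg : disjoint_list (map g s).
  apply: disjoint_list_map ds => z /s0 z0.
  by rewrite vsubr_ge0 leIl vle_subLR addrC -[leLHS]addr0 vle_add2l vmeet_ge0
    ?modulus_ge0.
have fN : qsum (map f s) <= N x ^+ q.
  (* Each truncation is below [modulus x], and by disjointness so is their sum. *)
  apply: qsum_le; split=> //; apply: disjoint_list_sum_le => //.
    exact: modulus_ge0.
  by rewrite all_map; apply/allP => z _ /=; exact: leIr.
have gN : qsum (map g s) <= N y ^+ q.
  apply: qsum_le; split=> //; apply: disjoint_list_sum_le => //.
    exact: modulus_ge0.
  rewrite all_map; apply/allP => z zs /=; apply: vsub_meet_le.
    exact: modulus_ge0.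
  apply: le_trans (mem_le_sum ds zs) _; apply: le_trans sxy _.
  exact: modulusD.
rewrite /qsum !big_map in fN gN.
apply: le_trans (minkowski_seq Nx Ny _ _ fN gN) => //.
apply: ler_sum => z _; rewrite lerXn2r ?nnegrE ?addr_ge0 //.
by rewrite -{1}[z](subrK (f z)) addrC ler_normD.
Qed.

(** Dividing a packing of [a *: x] by the absolute value of [a] gives a packing of [x]. *)
Lemma lower_q_normZ_le a x : N (a *: x) <= `|a| * N x.
Proof.
have [->|a0] := eqVneq a 0; first by rewrite scale0r lower_q_norm0 normr0 mul0r.
have ap : 0 < `|a| by rewrite normr_gt0.
have av : 0 <= `|a|^-1 by rewrite invr_ge0.
apply: lower_q_norm_le => [|s [ds sax]].
  by rewrite mulr_ge0 ?lower_q_norm_ge0.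
have : packing x [seq `|a|^-1 *: z | z <- s].
  split; first exact: disjoint_listZ.
  rewrite big_map -scaler_sumr; have := vscale_le2 av sax.
  by rewrite modulusZ scalerA mulVf ?scale1r ?gt_eqF.
move=> /qsum_le; rewrite /qsum big_map.
under eq_bigr do rewrite normrZ (ger0_norm av) exprMn.
by rewrite -mulr_sumr exprVn ler_pdivrMl ?exprn_gt0 // exprMn.
Qed.

Lemma lower_q_normZ a x : N (a *: x) = `|a| * N x.
Proof.
apply/le_anti; rewrite lower_q_normZ_le /=.
have [->|a0] := eqVneq a 0; first by rewrite normr0 mul0r lower_q_norm_ge0.
have := lower_q_normZ_le a^-1 (a *: x).
by rewrite scalerA mulVf // scale1r normfV ler_pdivlMl ?normr_gt0.
Qed.

Lemma equivalent_lower_q_norm : equivalent_norm N.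
Proof.
split; first split.
- exact: lower_q_normD.
- exact: lower_q_normZ.
- by move=> x Nx; apply/eqP; rewrite -normr_le0 -Nx norm_le_lower_q_norm.
exists 1, (`|C| + 1); split; [exact: ltr01 | by rewrite ltr_wpDl |].
by move=> x; rewrite mul1r norm_le_lower_q_norm lower_q_norm_le_norm.
Qed.

(** * Superadditivity on disjoint vectors and the Kadec-Klee property *)

(** A packing of [x] followed by one of [y] is a packing of [x + y]; the two suprema are taken one
    after the other. *)
Lemma lower_q_norm_disjoint x y : 0 <= x -> 0 <= y -> meet x y = 0 ->
  N x ^+ q + N y ^+ q <= N (x + y) ^+ q.
Proof.
move=> x0 y0 xy.
rewrite -lerBrDr lower_q_normX.
apply: ge_sup; first by exists (qsum [::]), [::] => //; exact: packing_nil.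
move=> _ [s [ds sx] <-]; rewrite lerBrDr -lerBrDl.
rewrite lower_q_normX; apply: ge_sup.
  by exists (qsum [::]), [::] => //; exact: packing_nil.
move=> _ [t [dt ty] <-]; rewrite lerBrDl /qsum -big_cat.
rewrite ge0_modulus // in sx; rewrite ge0_modulus // in ty.
apply: qsum_le; split.
  apply: disjoint_list_cat => //.
  by apply: meet0S sx ty xy; exact: disjoint_list_sum_ge0.
by rewrite big_cat ge0_modulus ?vaddr_ge0 // vleD.
Qed.

(* [|x| - w] and [|y| - w] are disjoint and both dominated by [|x + y|]. *)
Lemma lower_q_norm_sub_meet x y w : w = meet (modulus x) (modulus y) ->
  N (modulus x - w) ^+ q + N (modulus y - w) ^+ q <= N (x + y) ^+ q.
Proof.
move=> wE.
have x0 : 0 <= modulus x - w by rewrite wE vsubr_ge0 leIl.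
have y0 : 0 <= modulus y - w by rewrite wE vsubr_ge0 leIr.
have xy : meet (modulus x - w) (modulus y - w) = 0.
  by rewrite wE vsub_meet_disjoint.
apply: le_trans (lower_q_norm_disjoint x0 y0 xy) _.
rewrite lerXn2r ?nnegrE ?lower_q_norm_ge0 //; apply: lower_q_norm_mono.
rewrite (ge0_modulus (vaddr_ge0 x0 y0)) (meet0_addE xy) leUx.
apply/andP; split.
  rewrite wE; apply: vsub_meet_le; first exact: modulus_ge0.
  by rewrite addrC modulus_addKr.
rewrite wE meetC; apply: vsub_meet_le; first exact: modulus_ge0.
by rewrite addrC [x + y]addrC modulus_addKr.
Qed.

(** With the overlap [w] removed, [a = N (modulus x - w)] satisfies a^q + c^q <= 1, so a <= 1 - c^q
    / q by Bernoulli. Restoring the overlap costs [N w]. *)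
Lemma lower_q_norm_meet_gap x y w (c : R) : 0 <= c ->
  w = meet (modulus x) (modulus y) ->
  N (x + y) <= 1 -> c + N w <= N y -> N x <= 1 - c ^+ q / q%:R + N w.
Proof.
move=> c0 wE xy1 cy.
have qp : 0 < q%:R :> R by rewrite ltr0n.
have Nsub z : N z <= N (modulus z - w) + N w.
  rewrite -[leLHS]lower_q_norm_modulus -{1}[modulus z](subrK w).
  exact: lower_q_normD.
have cb : c <= N (modulus y - w) by have := Nsub y; lra.
set a := N (modulus x - w); have a0 : 0 <= a := lower_q_norm_ge0 _.
have acq : a ^+ q + c ^+ q <= 1.
  apply: (@le_trans _ _ (N (x + y) ^+ q)).
    apply: le_trans (lower_q_norm_sub_meet wE).
    by rewrite lerD2l lerXn2r ?nnegrE ?lower_q_norm_ge0.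
  by rewrite exprn_ile1 ?lower_q_norm_ge0.
have a1 : a <= 1.
  rewrite -(@ler_pXn2r _ q) ?nnegrE // expr1n.
  by have := exprn_ge0 q c0; lra.
have : c ^+ q / q%:R <= 1 - a.
  rewrite ler_pdivrMr // mulrC.
  by apply: le_trans (one_sub_exprn_le q _); [lra | rewrite a0].
by have := Nsub x; rewrite -/a; lra.
Qed.

Lemma tau_UKK_lower_q_norm : tau_UKK N.
Proof.
(* [e / 4] is what remains of [N (x_ n - x) >= e / 2] after an overlap of norm at most [e / 4]. The
   resulting loss is [c], half of which pays for the overlap. *)
move=> e e0; pose c := (e / 4) ^+ q / q%:R.
have qp : 0 < q%:R :> R by rewrite ltr0n.
have c0 : 0 < c by rewrite divr_gt0 ?exprn_gt0 // divr_gt0.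
exists (c / 2) => [|x_ x x1 sep cvg]; first by rewrite divr_gt0.
(* The divisor is the constant of [lower_q_norm_le_norm], which passes from the given norm of the
   overlap to [N]. *)
pose eta := Num.min (e / 4) (c / 2) / (`|C| + 1).
have Cp : 0 < `|C| + 1 by rewrite ltr_wpDl.
have e4 : 0 < e / 4 by lra.
have c2 : 0 < c / 2 by rewrite divr_gt0.
have eta0 : 0 < eta by rewrite divr_gt0 // lt_min e4 c2.
have sepN n m : n <> m -> e <= N (x_ n - x_ m).
  move=> nm; apply: le_trans sep _; apply: ge_inf; last by exists n, m.
  by exists 0 => _ [i [j [_ ->]]]; exact: lower_q_norm_ge0.
(* Convergence is tested on one neighborhood only, with truncation at [modulus x]. *)
have : tau_nbhs x [set y | `|meet (modulus (y - x)) (modulus x)| <= eta]%classic.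
  by exists (modulus x), eta; split=> //; exact: modulus_ge0.
move=> /cvg [K _ hK].
(* Either [K] or [K.+1] works: if both terms were closer than [e / 2] to [x], the triangle
   inequality would contradict their separation. *)
have [n Kn yn] : exists2 n, (K <= n)%N & e / 2 <= N (x_ n - x).
  have [h|h] := leP (e / 2) (N (x_ K - x)); first by exists K.
  exists K.+1 => //.
  have := sepN K K.+1 (@n_Sn K).
  have := lower_q_normD (x_ K - x) (- (x_ K.+1 - x)).
  rewrite lower_q_normN opprB addrA subrK.
  lra.
have := hK n Kn; rewrite /= meetC => wn.
set w := meet _ _ in wn.
have := @lower_q_norm_meet_gap x (x_ n - x) w (e / 4) (ltW e4) erefl.
rewrite [x + _]addrC subrK -/c.
have Nw : N w <= Num.min (e / 4) (c / 2).
  apply: le_trans (lower_q_norm_le_norm w) _.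
  by rewrite -ler_pdivlMl // mulrC.
move: Nw; rewrite le_min => /andP[Nw1 Nw2] /(_ (x1 n)) h.
have : N x <= 1 - c + N w by apply: h; lra.
lra.
Qed.

End Renorming.

Theorem corollary5 (R : realType) (X : banachLatticeType R) :
  ~ contains_linfty_uniformly X -> tau_UKK_able X.
Proof.
move=> /not_linfty_lower_bound[n n0 hn].
(* This fixes the exponent [q = n] and the constant [C = 2 * n%:R ^+ 2]. *)
have est s := @lower_estimate R X n s n0 hn.
exists (@lower_q_norm R X n); split.
  exact: equivalent_lower_q_norm n0 est.
exact: tau_UKK_lower_q_norm n0 est.
Qed.
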